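(* Let $K$ be the one-point compactification of a ladder system space on $\omega_1$, and let $\delta>0$. Then every $\delta$-$\prec$-chain in $C(K)$ is countable. In particular, $K$ satisfies condition (B).
   Context: A ladder system space on $\omega_1$ is the set $\omega_1$ with a topology defined as follows. Zero and each countable successor ordinal are isolated points. For each non-zero limit ordinal $\lambda<\omega_1$ one chooses a set (a ladder) $\{\alpha_{n,\lambda}\colon n<\omega\}\subseteq\lambda$ of order type $\omega$, consisting of successor ordinals and cofinal in $\lambda$; the basic open neighbourhoods of $\lambda$ are the sets $U_{\lambda,m}=\{\lambda\}\cup\{\alpha_{n,\lambda}\colon n\geqslant m\}$ ($m<\omega$). For any choice of ladders this space is locally compact and Hausdorff. $C(K)$ is the Banach space of all scalar-valued (real or complex) continuous functions on $K$ with the supremum norm. The support $\mathrm{supp}(f)$ of $f\in C(K)$ is the closure of $\{x\in K\colon f(x)\neq 0\}$. For $f,g\in C(K)$ write $f\prec g$ if $f\neq g$ and $f(x)=g(x)$ for every $x\in\mathrm{supp}(f)$; this is a strict (partial) ordering on $C(K)$. A $\prec$-chain is a subset of $C(K)$ any two distinct elements of which are comparable under $\prec$. For $\delta>0$, a $\delta$-$\prec$-chain is a $\prec$-chain $F$ with $\sup_{f\in F}\|f\|<\infty$ and $\|f-g\|\geqslant\delta$ for all distinct $f,g\in F$. A compact Hausdorff space $K$ satisfies condition (B) if for each uncountable $\prec$-chain $F$ in $C(K)$ with $\sup_{f\in F}\|f\|<\infty$ one has $\inf\{\|f-g\|\colon f,g\in F,\ f\neq g\}=0$; equivalently, for each $\delta>0$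 there is no uncountable $\delta$-$\prec$-chain in $C(K)$. *)

(* Defs.v *)
From HB Require Import structures.
From mathcomp Require Import all_boot all_order all_algebra.
From mathcomp Require Import complex.
From mathcomp Require wochoice.
From mathcomp Require Import all_classical all_reals all_analysis.
Import Order.TTheory GRing.Theory Num.Theory.
Import numFieldNormedType.Exports.

Set Implicit Arguments.
Unset Strict Implicit.
Unset Printing Implicit Defensive.

Local Open Scope classical_set_scope.
Local Open Scope ring_scope.

(* These properties determine the linear order W up to isomorphism: W is
   omega_1. *)
Record is_omega1 {d} (W : orderType d) : Prop := IsOmega1 {
  omega1_well_order : wochoice.well_order (<=%O : rel W);
  omega1_uncountable : ~ countable [set: W];
  omega1_segment : forall x : W, countable [set y : W | (y < x)%O]
}.

Definition is_zero {d} {W : orderType d} (x : W) : Prop :=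
  forall y : W, (x <= y)%O.

Definition is_succ {d} {W : orderType d} (x : W) : Prop :=
  exists p : W, (p < x)%O /\ forall y : W, (p < y)%O -> (x <= y)%O.

Definition is_limit {d} {W : orderType d} (x : W) : Prop :=
  ~ is_zero x /\ ~ is_succ x.

(* [rung l n] is alpha_{n,l}; its values at non-limit l are irrelevant. *)
Record ladder_system {d} (W : orderType d) := LadderSystem {
  rung : W -> nat -> W;
  rung_lt : forall l, is_limit l -> forall n, (rung l n < l)%O;
  rung_mono : forall l, is_limit l ->
    forall m n, (m < n)%N -> (rung l m < rung l n)%O;
  rung_succ : forall l, is_limit l -> forall n, is_succ (rung l n);
  rung_cofinal : forall l, is_limit l ->
    forall x, (x < l)%O -> exists n, (x <= rung l n)%O
}.

Definition ladder_space {d} {W : orderType d} (L : ladder_system W) : Type := W.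

Section LadderTopology.
Context {d} {W : orderType d} (L : ladder_system W).
Local Notation X := (ladder_space L).

Definition ladder_basic (x : X) (m : nat) : set X :=
  [set y | y = x \/
           (is_limit x /\ exists2 n, (m <= n)%N & y = rung L x n)].

Definition ladder_nbhs (x : X) : set_system X :=
  filter_from setT (ladder_basic x).

Lemma ladder_nbhs_filter (x : X) : ProperFilter (ladder_nbhs x).
Proof.
apply: filter_from_proper; last by move=> m _; exists x; left.
apply: filter_from_filter; first by exists 0%N.
move=> i j _ _; exists (maxn i j) => // y [->|[lx [n]]]; first by split; left.
by rewrite geq_max => /andP[? ?] ->; split; right; split=> //; exists n.
Qed.

Lemma ladder_nbhs_singleton (x : X) (A : set X) : ladder_nbhs x A -> A x.
Proof. by case=> m _; apply; left. Qed.

Lemma ladder_nbhs_nbhs (x : X) (A : set X) :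
  ladder_nbhs x A -> ladder_nbhs x (ladder_nbhs^~ A).
Proof.
move=> [m _ mA]; exists m => // y; case=> [->|[lx [n mn yE]]]; first by exists m.
exists 0%N => // z [->|[[_ ns] _]].
  by apply: mA; right; split=> //; exists n.
by exfalso; apply: ns; rewrite yE; exact: rung_succ.
Qed.

HB.instance Definition _ := Choice.copy X W.
HB.instance Definition _ := hasNbhs.Build X ladder_nbhs.
HB.instance Definition _ := @Nbhs_isNbhsTopological.Build X
  ladder_nbhs_filter ladder_nbhs_singleton ladder_nbhs_nbhs.

End LadderTopology.

Section LadderCompactification.
Context {d} {W : orderType d} (L : ladder_system W).
Local Notation X := (ladder_space L).

Lemma ladder_basic_le (x : X) (m : nat) (y : X) :
  ladder_basic x m y -> ((y : W) <= x)%O.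
Proof. by case=> [->//|[lx [n _ ->]]]; exact/ltW/rung_lt. Qed.

Lemma nbhs_ladder_basic (x : X) (m : nat) : nbhs x (ladder_basic x m).
Proof. by exists m. Qed.

Lemma ladder_basic_gt (x y : X) : ((x : W) < y)%O ->
  exists m, ladder_basic y m `<=` [set z : X | ((x : W) < z)%O].
Proof.
move=> xy; have [ly|nly] := pselect (is_limit (y : W)); last first.
  by exists 0%N => z [->//|[/nly]].
have [m xm] := rung_cofinal L ly xy.
exists m.+1 => z [->//|[_ [n mn ->]]] /=.
exact: (le_lt_trans xm (rung_mono L ly mn)).
Qed.

Lemma ladder_space_hausdorff : hausdorff_space X.
Proof.
move=> x y xy; apply: contrapT => /eqP nxy.
wlog lxy : x y xy nxy / ((x : W) < y)%O => [H|].
  have [/H|/H|//] := @ltgtP _ W x y; [exact| |exact/eqP].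
  by apply; [move=> A B xA yB; rewrite setIC; exact: xy|rewrite eq_sym].
have [m ym] := ladder_basic_gt lxy.
have [z [/ladder_basic_le zx /ym /= xz]] :=
  xy _ _ (nbhs_ladder_basic x 0) (nbhs_ladder_basic y m).
by have := lt_le_trans xz zx; rewrite ltxx.
Qed.

Lemma ladder_basic_compact (x : X) (m : nat) : compact (ladder_basic x m).
Proof.
apply/compact_near_coveringP => I F P FF HP.
have [[A B] [[k _ kA] FB] AB] := HP x (or_introl erefl).
have fin : finite_set [set y : X |
    is_limit (x : W) /\ exists2 n, (m <= n < k)%N & y = rung L x n].
  apply: (@sub_finite_set _ _ ((rung L x : nat -> X) @` `I_k)).
    by move=> y [_ [n /andP[_ nk] ->]]; exists n.
  exact/finite_image/finite_II.
have /compact_near_coveringP/(_ I F P FF) H := finite_compact fin.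
have {}H : \forall i \near F, forall y : X, (is_limit (x : W) /\
    exists2 n, (m <= n < k)%N & y = rung L x n) -> P i y.
  apply: H => y [lx [n /andP[mn _] yE]]; apply: HP.
  by right; split=> //; exists n.
apply: filterS2 H FB => i Pi Bi y [->|[lx [n mn yE]]].
  by apply: (AB (x, i)); split => //; apply: kA; left.
have [nk|kn] := ltnP n k.
  by apply: Pi; split=> //; exists n => //; rewrite mn nk.
by apply: (AB (y, i)); split => //; apply: kA; right; split=> //; exists n.
Qed.

Lemma ladder_space_locally_compact : locally_compact [set: X].
Proof.
move=> x _; rewrite withinET; exists (ladder_basic x 0).
  exact: nbhs_ladder_basic.
split; first exact: ladder_basic_compact.
exact: compact_closed ladder_space_hausdorff (@ladder_basic_compact x 0).
Qed.

Lemma ladder_compactification_hausdorff :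
  hausdorff_space (one_point_compactification X).
Proof.
exact: one_point_compactification_hausdorff ladder_space_locally_compact
  ladder_space_hausdorff.
Qed.

End LadderCompactification.

Variant scalars := RealScalars | ComplexScalars.

Definition scalar_field (R : realType) (s : scalars) : numFieldType :=
  match s with RealScalars => R | ComplexScalars => R[i] end.

(* The norm of R[i] takes its values in R[i], whereas [ComplexField.Normc.normc]
   is the modulus with values in R. *)
Definition modulus (R : realType) (s : scalars) : scalar_field R s -> R :=
  match s with
  | RealScalars => fun x : R => `|x|
  | ComplexScalars => fun z : R[i] => ComplexField.Normc.normc z
  end.

Section ContinuousFunctions.
Context (R : realType) (s : scalars) (K : topologicalType).
Local Notation CK := (continuousType K (scalar_field R s)).
Implicit Types (f g : CK) (F : set CK).

Definition supp f : set K := closure [set x | f x != 0].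

Definition prec f g : Prop := f <> g /\ forall x, supp f x -> f x = g x.

Definition prec_chain F : Prop :=
  forall f g, F f -> F g -> f <> g -> prec f g \/ prec g f.

Definition supnorm (h : K -> scalar_field R s) : R :=
  sup (range (fun x => modulus (h x))).

Definition supdist f g : R := supnorm (fun x => f x - g x).

Definition norm_bounded F : Prop := has_ubound [set supnorm f | f in F].

Definition delta_prec_chain (delta : R) F : Prop :=
  [/\ prec_chain F, norm_bounded F &
      forall f g, F f -> F g -> f <> g -> delta <= supdist f g].

Definition condition_B : Prop :=
  forall F, prec_chain F -> norm_bounded F -> ~ countable F ->
    inf [set e | exists f g, [/\ F f, F g, f <> g & e = supdist f g]] = 0.

End ContinuousFunctions.

(* Main.v *)
Require Import Defs.
From mathcomp Require Import all_boot all_order all_algebra.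
From mathcomp Require Import complex finmap.
From mathcomp Require Import all_classical all_reals all_analysis.
Import Order.TTheory GRing.Theory Num.Theory.
Import numFieldNormedType.Exports.

(** A bounded separated chain is countable because its members can be told
apart by finitely many natural numbers.

Let [e = delta / 2]. If [f] precedes [g], then [g] agrees with [f] wherever [f]
is nonzero, so the distance between them is witnessed at a point where [f]
vanishes and [|g| > e] ([prec_supdist_gt]). Split the chain according to
whether its members vanish at the point at infinity. To a member that vanishes
there attach the sets

   A = {|f| >= e}   and   O = {f != 0},

and to any other member

   A = {f = 0}      and   O = {|f| < e}.

In both cases [A] is a compact subset of the ladder space (it is closed and
misses infinity) and [O] is an open set containing it. Along the chain [A]
increases in the first case and decreases in the second. The separation of
two members says that the larger of the two sets [A] is not contained in the
set [O] attached to the smaller one.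

The topology of the ladder space enters through one fact, [pair_code_sub].
A compact [A] contains finitely many limits, and the [m]-th tails of their
ladders, with the limits themselves, cover all but finitely many points of
[A]; if [m] is large, these tails lie inside [O]. Encode [(A, O)] by [m], the
number of limits in [A] and the number of points of [A] off the tails. If [A]
is contained in [A'] and the two pairs have the same code, then [A] and [A']
have the same limits (nested finite sets of equal cardinality), hence the same
tails, hence the same points off the tails; so [A' = A] up to the tails, and
[A'] is contained in [O]. Thus two members of the chain in the same case
cannot share a code, and the chain injects into a countable set of codes.

Condition (B) follows by taking for [delta] the infimum of the distances,
were it positive. *)

Set Implicit Arguments.
Unset Strict Implicit.

Local Open Scope classical_set_scope.
Local Open Scope ring_scope.

(** * Finite sets and finite covers *)

Lemma subset_finite_card_eq (T : choiceType) (A B : set T) :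
  finite_set B -> A `<=` B ->
  (#|` fset_set A| = #|` fset_set B|)%fset -> A = B.
Proof.
move=> finB AB AB_card; have finA := sub_finite_set AB finB.
apply: fset_set_inj => //; apply/eqP.
by rewrite eqEfcard AB_card leqnn andbT -fset_set_sub//; apply/asboolP.
Qed.

(** This is near-covering compactness for the filter of finite subsets of [A]
ordered by inclusion. The centres of the cover lie in [A], so a limit among
them is a limit of [A] and its tail is one of the tails removed from [A]. *)
Lemma compact_finite_nbhs_cover (T : topologicalType) (A : set T)
    (U : T -> set T) : (forall x, A x -> nbhs x (U x)) -> compact A ->
  exists2 D : set T, finite_set D & D `<=` A /\ A `<=` \bigcup_(x in D) U x.
Proof.
move=> nU /compact_near_coveringP cA.
pose FA := filter_from [set D : set T | finite_set D /\ D `<=` A]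
  (fun D => [set E | D `<=` E]).
have FF : Filter FA.
  apply: filter_from_filter; first by exists set0; split.
  move=> D E [finD DA] [finE EA]; exists (D `|` E).
    by split; [rewrite finite_setU | rewrite subUset].
  by move=> G DEG; split => x ?; apply: DEG; [left|right].
have [x Ax|D [finD DA] AD] := cA _ FA (fun D y => (\bigcup_(x in D) U x) y) FF.
  exists (U x, [set D | D x]) => [|[y D] [/= Uy Dx]]; last by exists x.
  split; first exact: nU.
  exists [set x]; first by split; [exact: finite_set1 | move=> _ ->].
  by move=> D /(_ x erefl).
by exists D => //; split => // x Ax; exact: AD.
Qed.

(** * Compact subsets of a ladder space *)

Section CompactSetsOfLadderSpace.
Context {d : Order.disp_t} {W : orderType d} (L : ladder_system W).
Local Notation X := (ladder_space L).
Implicit Types (A O : set X) (x y : X) (m : nat).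

Definition limits A : set X := [set x | A x /\ is_limit (x : W)].

Definition tails A m : set X := \bigcup_(l in limits A) ladder_basic (l : X) m.

(** The other points of a basic neighbourhood are successors, so each basic
neighbourhood contains at most one limit. *)
Lemma ladder_basic_limit x y m :
  ladder_basic x m y -> is_limit (y : W) -> y = x.
Proof. by case=> [//|[lx [n _ ->]]] [_]; case; exact: rung_succ. Qed.

(** A successor is its own basic neighbourhood, so the only case in which
something happens is [y = x], where the tail merely gets shorter. This makes
the choice of a tail uniform near [x]. *)
Lemma ladder_basic_trans x y z k m : (k <= m)%N ->
  ladder_basic x k y -> ladder_basic y m z -> ladder_basic x k z.
Proof.
move=> km xy [->//|[ly [n mn ->]]].
have yx := ladder_basic_limit xy ly; rewrite -yx; right; split => //.
by exists n => //; exact: leq_trans mn.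
Qed.

(** Every limit of [A] must be the centre of the basic set that covers it in a
finite cover. *)
Lemma compact_finite_limits A : compact A -> finite_set (limits A).
Proof.
move=> /(compact_finite_nbhs_cover
  (fun x _ => nbhs_ladder_basic x 0))[D finD [_ AD]].
apply: sub_finite_set finD => y [/AD[x Dx /= xy] ly].
by rewrite (ladder_basic_limit xy ly).
Qed.

(** A finite cover of [A] by basic sets centred in [A] consists of singletons
and of pieces of the tails. *)
Lemma compact_finite_off_tails A m : compact A -> finite_set (A `\` tails A m).
Proof.
move=> /(compact_finite_nbhs_cover
  (fun x _ => nbhs_ladder_basic x m))[D finD [DA AD]].
apply: sub_finite_set finD => y [/AD[x Dx /= xy] ntails].
case: (xy) => [->//|[lx _]]; exfalso; apply: ntails.
by exists x => //; split => //; exact: DA.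
Qed.

(** The index of a tail that fits into [O] can be chosen locally uniformly, so
compactness gives one index for all of [A]. *)
Lemma compact_uniform_tails A O : compact A -> open O -> A `<=` O ->
  exists m, tails A m `<=` O.
Proof.
move=> /compact_near_coveringP/(_ nat \oo
  (fun m x => (ladder_basic x m : set X) `<=` O)) cA oO AO.
have [x Ax|m _ mO] := cA _.
  move: oO; rewrite openE => /(_ x (AO x Ax)) [k _ kO].
  exists (ladder_basic x k, [set m | (k <= m)%N]) => /=.
    by split; [exists k|exists k].
  move=> [y m] [/= xy km] z yz; apply: kO.
  exact: ladder_basic_trans xy yz.
by exists m => y [x [Ax _]]; exact: (mO m (leqnn m) x Ax y).
Qed.

(** The code consists of a tail index [m] that fits [O], the number of limits
of [A], and the number of points of [A] outside the corresponding tails. It is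
a relation because [m] is far from unique. *)
Definition pair_code A O (c : nat * nat * nat) : Prop :=
  let: (m, p, q) := c in
  [/\ tails A m `<=` O, (#|` fset_set (limits A)| = p)%fset &
      (#|` fset_set (A `\` tails A m)| = q)%fset].

Lemma pair_code_exists A O : compact A -> open O -> A `<=` O ->
  exists c, pair_code A O c.
Proof.
move=> cA oO AO; have [m mO] := compact_uniform_tails cA oO AO.
by eexists (m, _, _); split => //.
Qed.

(** Nested finite sets of equal cardinality coincide; this is used first for
the limits and then, the tails being now the same, for the remaining
points. *)
Lemma pair_code_sub A A' O O' c :
  compact A' -> A `<=` O -> A `<=` A' ->
  pair_code A O c -> pair_code A' O' c -> A' `<=` O.
Proof.
case: c => [[m p] q] cA' AO AA' [AmO Ap Aq] [_ A'p A'q].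
have limE : limits A = limits A'.
  apply: subset_finite_card_eq; last by rewrite Ap A'p.
    exact: compact_finite_limits.
  by move=> x [/AA'].
have tailsE : tails A m = tails A' m by rewrite /tails limE.
have offE : A `\` tails A m = A' `\` tails A' m.
  apply: subset_finite_card_eq; last by rewrite Aq A'q.
    exact: compact_finite_off_tails.
  by rewrite tailsE; exact: setSD.
move=> x A'x; have [xm|nxm] := pselect (tails A' m x).
  by apply: AmO; rewrite tailsE.
by apply: AO; have [] : (A `\` tails A m) x by rewrite offE.
Qed.

End CompactSetsOfLadderSpace.

(** * Closed sets that miss the point at infinity *)

Lemma compact_preimage_Some (X : topologicalType)
    (B : set (one_point_compactification X)) :
  closed B -> ~ B None -> compact (Some @^-1` B).
Proof.
move=> cB BN; have : nbhs (None : one_point_compactification X) (~` B).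
  by apply: open_nbhs_nbhs; split=> //; exact: closed_openC.
move=> [C [cC _] CB]; apply: subclosed_compact cC _.
  apply: closed_comp cB => x _.
  exact: one_point_compactification_some_continuous.
move=> x Bx; apply: contrapT => nCx.
by apply: (CB (Some x)) => //; left; exists x.
Qed.

(** * The modulus of a real or complex scalar *)

Section Modulus.
Context (R : realType) (s : scalars).
Implicit Type z : scalar_field R s.

Lemma modulus0 : modulus (0 : scalar_field R s) = 0.
Proof.
by case: s => /=; [exact: normr0 | exact: ComplexField.Normc.normc0].
Qed.

Lemma modulusN z : modulus (- z) = modulus z.
Proof.
by case: s z => [z|[a b]] /=; [exact: normrN | rewrite !sqrrN].
Qed.

Lemma modulus_ge0 z : 0 <= modulus z.
Proof. by case: s z => /= [z//|[a b]]; exact: sqrtr_ge0. Qed.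

(** The set is a ball of the scalar field; in the complex case the radius of
that ball is itself a complex number. *)
Lemma open_modulus_lt (e : R) : open [set z : scalar_field R s | modulus z < e].
Proof.
have [e' zE] : exists e' : scalar_field R s,
    forall z, (modulus z < e) = (`|z| < e').
  case: s => [|]; first by exists e.
  by exists (e%:C)%C => -[a b] /=; rewrite normc_def ltcR.
rewrite (_ : [set _ | _] = ball (0 : scalar_field R s) e').
  exact: ball_open.
by apply/seteqP; split=> z; rewrite -ball_normE/= sub0r normrN zE.
Qed.

End Modulus.

(** * Codes for the members of a chain *)

Section Chains.
Context (R : realType) (s : scalars).

Lemma supdist_ge0 (K : topologicalType)
    (f g : continuousType K (scalar_field R s)) : 0 <= supdist f g.
Proof.
rewrite /supdist /supnorm; set E := (X in sup X).
have [[]|noE] := pselect (has_sup E); last by rewrite sup_out.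
move=> [r Er] ubE; apply: (@le_trans _ _ r); last exact: ub_le_sup.
by case: Er => x _ <-; exact: modulus_ge0.
Qed.

(** Where [f] is nonzero it agrees with [g], so only the zeros of [f]
contribute to the distance. *)
Lemma prec_supdist_gt (K : topologicalType) (e : R)
    (f g : continuousType K (scalar_field R s)) :
  0 < e -> prec f g -> e < supdist f g ->
  exists x, f x = 0 /\ e < modulus (g x).
Proof.
move=> e0 [_ fg] efg.
have [_ [x _ <-] ex] :
    exists2 r, range (fun x => modulus (f x - g x)) r & e < r.
  (* On an empty space the supremum is 0, which the hypothesis excludes. *)
  apply: sup_gt => //; apply/set0P/eqP => E0.
  by move: efg; rewrite /supdist /supnorm E0 sup0 ltNge (ltW e0).
exists x; have [fx0|fx0] := eqVneq (f x) 0.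
  by split => //; move: ex; rewrite fx0 sub0r modulusN.
move: ex; rewrite fg ?subrr ?modulus0 ?ltNge ?(ltW e0)//.
exact: subset_closure.
Qed.

Context {d : Order.disp_t} {W : orderType d} (L : ladder_system W).
Local Notation X := (ladder_space L).
Local Notation K := (one_point_compactification X).
Local Notation CK := (continuousType K (scalar_field R s)).
Implicit Types (f g : CK) (F : set CK) (e : R).

Definition large f e : set K := [set x | e <= modulus (f x)].
Definition small f e : set K := [set x | modulus (f x) < e].
Definition zeros f : set K := [set x | f x = 0].
Definition nonzeros f : set K := [set x | f x != 0].

Lemma small_open f e : open (small f e).
Proof.
apply: (@open_comp _ _ f [set z | modulus z < e] _ (@open_modulus_lt R s e)).
by move=> x _; exact: cts_fun.
Qed.

Lemma large_closed f e : closed (large f e).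
Proof.
rewrite (_ : large f e = ~` small f e); first exact/open_closedC/small_open.
by apply/seteqP; split => x; rewrite /large /small /= leNgt => /negP.
Qed.

Lemma nonzeros_open f : open (nonzeros f).
Proof.
rewrite (_ : nonzeros f = f @^-1` (~` [set 0])).
  apply: open_comp => [x _|]; first exact: cts_fun.
  apply/closed_openC/accessible_closed_set1/hausdorff_accessible.
  exact: norm_hausdorff.
by apply/seteqP; split => x /= /eqP.
Qed.

Lemma zeros_closed f : closed (zeros f).
Proof.
rewrite (_ : zeros f = ~` nonzeros f); first exact/open_closedC/nonzeros_open.
apply/seteqP; split => x; rewrite /zeros /nonzeros /=.
  by move=> ->; rewrite eqxx.
by move=> /negP; rewrite negbK => /eqP.
Qed.

Lemma prec_nonzeros f g x : prec f g -> f x != 0 -> f x = g x.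
Proof. by case=> _ fg fx; apply: fg; exact: subset_closure. Qed.

(** The boolean records whether [f] vanishes at infinity; it decides which of
the two compact sets is bounded away from infinity and can be encoded. *)
Definition fun_code e f (c : bool * (nat * nat * nat)) : Prop :=
  c.1 = (f None == 0) /\
  if c.1
  then pair_code (L := L) (Some @^-1` large f e) (Some @^-1` nonzeros f) c.2
  else pair_code (L := L) (Some @^-1` zeros f) (Some @^-1` small f e) c.2.

Lemma open_preimage_Some (U : set K) : open U -> open (Some @^-1` U : set X).
Proof.
by apply: open_comp => x _; exact: one_point_compactification_some_continuous.
Qed.

Lemma large_nonzeros e f : 0 < e -> large f e `<=` nonzeros f.
Proof.
move=> e0 x; rewrite /large /nonzeros /=; apply: contraTneq => ->.
by rewrite modulus0 -ltNge.
Qed.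

Lemma zeros_small e f : 0 < e -> zeros f `<=` small f e.
Proof. by move=> e0 x; rewrite /zeros /small /= => ->; rewrite modulus0. Qed.

Lemma large_compact e f : 0 < e -> f None = 0 ->
  compact (Some @^-1` large f e : set X).
Proof.
move=> e0 fN; apply: compact_preimage_Some; first exact: large_closed.
by move=> /(large_nonzeros e0); rewrite /nonzeros /= fN eqxx.
Qed.

Lemma zeros_compact f : f None <> 0 -> compact (Some @^-1` zeros f : set X).
Proof.
by move=> fN; apply: compact_preimage_Some; first exact: zeros_closed.
Qed.

Lemma fun_code_exists e f : 0 < e -> exists c, fun_code e f c.
Proof.
move=> e0; have [fN|fN] := eqVneq (f None) 0.
  have [c fc] := pair_code_exists (large_compact e0 fN)
    (open_preimage_Some (@nonzeros_open f))
    (fun x => @large_nonzeros e f e0 (Some x)).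
  by exists (true, c); split; rewrite //= fN eqxx.
have [c fc] := pair_code_exists (zeros_compact (elimN eqP fN))
  (open_preimage_Some (@small_open f e))
  (fun x => @zeros_small e f e0 (Some x)).
by exists (false, c); split; rewrite //= (negbTE fN).
Qed.

(** The point [x] with [f x = 0] and [e < |g x|] is what the codes exclude: if
both functions vanish at infinity, [x] lies in the set attached to [g] and must
therefore lie in the neighbourhood attached to [f]; otherwise the roles of [f]
and [g] are exchanged. *)
Lemma fun_code_separated e f g c : 0 < e -> prec f g -> e < supdist f g ->
  fun_code e f c -> fun_code e g c -> False.
Proof.
move=> e0 fg efg; have [[x|] [fx egx]] := prec_supdist_gt e0 fg efg; last first.
  (* At infinity [f] vanishes and [g] does not, so the booleans differ. *)
  move=> [cf _] [cg _]; move: cg; rewrite cf fx eqxx => /esym/eqP gN.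
  by move: egx; rewrite gN modulus0 ltNge (ltW e0).
case: c => -[] c [/= cf fc] [/= cg gc].
  have : (Some @^-1` nonzeros f) x.
    apply: (pair_code_sub _ _ _ fc gc) => [|y|y|]; last exact: ltW.
    - by apply: large_compact => //; apply/eqP; rewrite -cg.
    - exact: large_nonzeros.
    - move=> ef; rewrite /large /= -(prec_nonzeros fg)//.
      exact: large_nonzeros ef.
  by rewrite /nonzeros /= fx eqxx.
have : (Some @^-1` small g e) x.
  apply: (pair_code_sub _ _ _ gc fc) => [|y|y|//].
  - by apply: zeros_compact; apply/eqP; rewrite -cf.
  - exact: zeros_small.
  - rewrite /zeros /= => gy; apply/eqP; apply: contrapT => /negP fy.
    by move: (fy); rewrite (prec_nonzeros fg fy) gy eqxx.
by rewrite /small /= ltNge (ltW egx).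
Qed.

Lemma delta_prec_chain_countable (delta : R) F :
  0 < delta -> delta_prec_chain delta F -> countable F.
Proof.
move=> delta0 [chainF _ sepF]; pose e := delta / 2.
have e0 : 0 < e by rewrite divr_gt0.
have elt f g : F f -> F g -> f <> g -> e < supdist f g.
  move=> Ff Fg fg; apply: lt_le_trans (sepF f g Ff Fg fg).
  by rewrite ltr_pdivrMr// ltr_pMr// ltr1n.
have [code codeP] := choice (fun f => fun_code_exists f e0).
apply: sub_countable (countableP [set: bool * (nat * nat * nat)]).
apply/pcard_injP; exists code => f g /[!inE] Ff Fg fg_code.
apply: contrapT => fg.
have cf := codeP f; have cg := codeP g; rewrite fg_code in cf.
have [pfg|pgf] := chainF f g Ff Fg fg.
  exact: (fun_code_separated e0 pfg (elt _ _ Ff Fg fg) cf cg).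
exact: (fun_code_separated e0 pgf (elt _ _ Fg Ff (nesym fg)) cg cf).
Qed.

Lemma ladder_compactification_condition_B : condition_B R s K.
Proof.
move=> F chainF boundF uncF.
set E := [set e | _].
have E0 : lbound E 0 by move=> _ [f [g [_ _ _ ->]]]; exact: supdist_ge0.
have [EE|/set0P En0] := eqVneq E set0; first by rewrite EE inf0.
apply/eqP; rewrite eq_le lb_le_inf// andbT leNgt; apply/negP => Egt0.
apply: uncF; apply: (delta_prec_chain_countable Egt0); split => // f g Ff Fg fg.
by apply: ge_inf; [exists 0 | exists f, g].
Qed.

End Chains.

Theorem theorem3p8 (R : realType) (s : scalars)
    (d : Order.disp_t) (W : orderType d) (hW : is_omega1 W)
    (L : ladder_system W) (delta : R) (hdelta : 0 < delta) :
  (forall F : set (continuousType (one_point_compactification (ladder_space L))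
                                  (scalar_field R s)),
     delta_prec_chain delta F -> countable F) /\
  condition_B R s (one_point_compactification (ladder_space L)).
Proof.
split; last exact: ladder_compactification_condition_B.
by move=> F; exact: delta_prec_chain_countable.
Qed.
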